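(* Let $n \geq 3$. The maximum of $\mathcal{O}(v,w) = \#\{\sigma \in S_n : w \cdot \sigma v = 0\}$ over all $v, w \in \mathbb{R}^n$ such that $v$ has pairwise distinct coordinates and $v \cdot \mathbf{1} \neq 0$ equals \[ 2\lfloor n/2 \rfloor (n-2)! = \begin{cases} (n-1)! & \text{if } n \text{ is odd},\\ n(n-2)! & \text{if } n \text{ is even}.\end{cases} \]
   Context: A permutation $\sigma \in S_n$ acts on $v \in \mathbb{R}^n$ by $\sigma v = (v_{\sigma^{-1}(1)}, \ldots, v_{\sigma^{-1}(n)})$. Here $\cdot$ is the standard dot product on $\mathbb{R}^n$ and $\mathbf{1} = (1,1,\ldots,1) \in \mathbb{R}^n$.
   Formalization: The formal theorem additionally requires w ≠ 0; with w = 0 allowed, every permutation is counted, so O(v,0) = n! exceeds the claimed maximum for all n ≥ 3. *)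

(* Defs.v *)
From HB Require Import structures.
From mathcomp Require Import all_boot all_order all_algebra all_fingroup.
From mathcomp Require Import reals.

Set Implicit Arguments.
Unset Strict Implicit.
Unset Printing Implicit Defensive.

Import Order.TTheory GRing.Theory Num.Theory.
Local Open Scope ring_scope.

Definition dotv (R : realType) (n : nat) (u v : 'rV[R]_n) : R :=
  \sum_(i < n) u ord0 i * v ord0 i.

Definition permv (R : realType) (n : nat) (s : 'S_n) (v : 'rV[R]_n) : 'rV[R]_n :=
  \row_(i < n) v ord0 ((s^-1)%g i).

Definition orthcount (R : realType) (n : nat) (v w : 'rV[R]_n) : nat :=
  #|[set s : 'S_n | dotv w (permv s v) == 0]|.

Definition distinct_coords (R : realType) (n : nat) (v : 'rV[R]_n) : Prop :=
  injective (fun i : 'I_n => v ord0 i).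

(* The condition [w != 0] says that the orthogonal complement of [w] is a
   hyperplane; for [w = 0] every permutation would be counted. *)
Definition admissible (R : realType) (n : nat) (v w : 'rV[R]_n) : Prop :=
  [/\ distinct_coords v, dotv v (const_mx 1) != 0 & w != 0].

Definition is_maximum (A : nat -> Prop) (m : nat) : Prop :=
  A m /\ (forall k : nat, A k -> (k <= m)%N).

(* Main.v *)
Require Import Defs.
From HB Require Import structures.
From mathcomp Require Import all_boot all_order all_algebra all_fingroup.
From mathcomp Require Import reals zify ring.

Set Implicit Arguments.
Unset Strict Implicit.
Unset Printing Implicit Defensive.

(** Fix a cut of [w] into large and small entries, with [k] large ones.  Each
    pattern of placing the coordinates of [v] in increasing order inside both
    blocks makes [w . s v] strictly monotone in the set of coordinates of [v]
    placed on the large block, for the componentwise order on [k]-subsets.  So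
    for each pattern the solutions form an antichain, and it suffices that an
    antichain of [k]-subsets of an [n]-set has at most ['C(n, k) / n] elements
    for [n] odd; the bound ['C(n, k) / (n - 1)] for [n] even follows by deciding
    one element.

    For [n = 2m + 1] and [k <= m], induct by removing the minimum [a] and the
    maximum [b] of the ground set.  The members containing both or none of [a],
    [b] are bounded by induction.  The sets [T + x + a] and [T + x + b], for
    fixed [T] of size [k - 2] and varying [x], form one chain, so the members
    containing exactly one of [a], [b] number at most ['C(n-2, k-2) / (k-1)].
    This is enough for [k < m].  For [k = m] one also counts the [T] that do not
    extend to a member: when [T0] has size [k - 3], those [z] for which [T0 + z]
    extends are matched in pairs, which by parity leaves an unmatched [z] for
    each [T0] if [m] is odd; if [m] is even, a rank comparison shows that among
    the [T0 = R + t] with fixed [R] only about half admit a perfect matching.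

    Equality is attained by [v_i = i] and [w = e_0 + e_1 - (2 / n) 1]. *)

(** * Arithmetic inequalities *)

Lemma leq_indic x a b : a <= b -> (x <= a) <= (x <= b).
Proof. by move=> h; case: (leqP x a) => // xa; rewrite (leq_trans xa h). Qed.

(** Raising the bit from 0 to 1 lowers the threshold by one, which switches off at most one of the
    two indicators because [r1] and [r2] differ; the bit itself makes up for it. *)
Lemma leq_shifted_indic (r1 r2 u c : nat) (b b' : bool) : r1 <> r2 -> b <= b' ->
  (r2 < u - b) + ((r1 < u - b) + (b + c)) <= (r2 < u - b') + ((r1 < u - b') + (b' + c)).
Proof.
case: b b' => [] [] //= h _; rewrite subn0.
by case: (ltnP r1 u) => h1; case: (ltnP r2 u) => h2;
  case: (ltnP r1 (u - 1)) => h3; case: (ltnP r2 (u - 1)) => h4; lia.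
Qed.

Lemma odd_addn_gt0 (a b N : nat) : odd N -> ~~ odd b -> a + b = N -> 0 < a.
Proof. by case: a => // oN ob e; move: oN; rewrite -e add0n (negbTE ob). Qed.

Lemma even_addn_gt1 (a b N : nat) : ~~ odd N -> ~~ odd b -> a + b = N -> b < N -> 1 < a.
Proof.
move=> oN ob e; rewrite -e in oN *; case: a {e} oN => [|[|a]] //=; first by rewrite add0n ltnn.
by rewrite add1n /= negbK (negbTE ob).
Qed.

(** In the application [c0], [c1], [c2] are the binomials of [2k + 3] at [k], [k - 1], [k - 2],
    while [q] counts perfect sets and [b] bad ones. Elimination gives [c0 <= (k + 5) * b], and
    [k >= 2] does the rest. *)
Lemma central_bad_ineq (i c0 c1 c2 q b : nat) (k := i.+2) :
  k * c0 = (k + 4) * c1 -> i.+1 * c1 = (k + 5) * c2 ->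
  2 * (i.+1 * q) <= (k + 6) * c2 -> 2 * c1 <= k * b + 2 * q ->
  c0 <= k.*2.+3 * b.
Proof.
move=> e0 e1 hq hb.
have h1 : 2 * ((k + 5) * q) <= (k + 6) * c1.
  rewrite -(leq_pmul2l (ltn0Sn i)).
  have -> : i.+1 * (2 * ((k + 5) * q)) = (k + 5) * (2 * (i.+1 * q)) by lia.
  have -> : i.+1 * ((k + 6) * c1) = (k + 5) * ((k + 6) * c2).
    by rewrite mulnCA e1 mulnCA.
  by rewrite leq_mul2l hq orbT.
have h2 : (k + 5) * (2 * c1) <= (k + 5) * (k * b + 2 * q) by rewrite leq_mul2l hb orbT.
have h3 : k * c0 <= k * ((k + 5) * b) by lia.
rewrite leq_pmul2l // in h3; apply: (leq_trans h3).
by rewrite leq_mul2r /k; apply/orP; right; lia.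
Qed.

(** The pair [q = 2], [s = 1] is left out because the inequality fails there: it would read
    [513 <= 504]. *)
Lemma extrema_poly q s : (3 <= q) && (1 <= s) || (2 <= q) && (2 <= s) ->
  let p := q + s.*2.+1 in let N := p + q in let k := q.+1 in
  (N + 2) * (q * k + p * p.+1 + N * k) <= N * (p * p.+1 + 2 * (k * p.+1) + q * k).
Proof.
case/orP=> /andP[/subnKC <- /subnKC <-]; move: (q - _) (s - _) => u v /=; nia.
Qed.

Lemma extrema_poly_central q :
  let p := q.+1 in let N := p + q in let k := q.+1 in
  (N + 2) * (q * k + p * p.+1 + (N - 1) * k) <= N * (p * p.+1 + 2 * (k * p.+1) + q * k).
Proof. move=> /=; nia. Qed.

(** [X2], [X1], [Y] stand for consecutive binomials of [N]. Once all terms are multiples of [Y], the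
    last hypothesis is what remains. The factor [c] will be [N - 1] in the central case and [N]
    otherwise. *)
Lemma extrema_step_ineq N p q k c f0 f1 z X2 X1 Y : 0 < N -> 0 < q -> 0 < k ->
  N * f1 <= Y -> N * f0 <= X2 -> N * (q * z) <= c * Y ->
  q * X1 = p.+1 * Y -> k * X2 = p * X1 ->
  (N + 2) * (q * k + p * p.+1 + c * k) <= N * (p * p.+1 + 2 * (k * p.+1) + q * k) ->
  (N + 2) * (f1 + f0 + z) <= X2 + 2 * X1 + Y.
Proof.
move=> N0 q0 k0 h1 h0 hz e1 e2 hp.
have M0 : 0 < N * (q * k) by rewrite !muln_gt0 N0 q0.
rewrite -(leq_pmul2l M0).
have e3 : q * k * X2 = p * p.+1 * Y by rewrite -mulnA e2 mulnCA e1 mulnA.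
have a1 : q * k * (N * f1) <= q * k * Y by rewrite leq_mul2l h1 orbT.
have a0 : q * k * (N * f0) <= p * p.+1 * Y by rewrite -e3 leq_mul2l h0 orbT.
have az : k * (N * (q * z)) <= k * (c * Y) by rewrite leq_mul2l hz orbT.
have R : N * (q * k) * (X2 + 2 * X1 + Y) = N * (p * p.+1 + 2 * (k * p.+1) + q * k) * Y.
  have -> : N * (q * k) * (X2 + 2 * X1 + Y) = N * (q * k * X2 + 2 * (k * (q * X1)) + q * k * Y) by lia.
  rewrite e3 e1; lia.
have L : N * (q * k) * ((N + 2) * (f1 + f0 + z)) <= (N + 2) * (q * k + p * p.+1 + c * k) * Y.
  have -> : N * (q * k) * ((N + 2) * (f1 + f0 + z)) =
    (N + 2) * (q * k * (N * f1) + q * k * (N * f0) + k * (N * (q * z))) by lia.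
  rewrite -[X in _ <= X]mulnA leq_mul2l !mulnDl; apply/orP; right.
  by rewrite -[c * k * Y]mulnA [c * (k * Y)]mulnCA; apply: leq_add az; apply: leq_add.
by apply: leq_trans L _; rewrite R leq_mul2r hp orbT.
Qed.

(** * Antichains of subsets *)

Section Dominance.
Variables (I : finType) (rho : I -> nat).
Hypothesis rho_inj : injective rho.
Implicit Types (V S T Z : {set I}) (F A B : {set {set I}}) (z y t : I).

(* [dom] is the componentwise order of the increasing enumerations when [S] and
   [T] have the same size. *)
Definition upc (x : nat) S : nat := \sum_(s in S) (x <= rho s).
Definition dom S T := forall x, upc x S <= upc x T.
Definition antichain F := {in F &, forall S T, dom S T -> S = T}.
Definition ksub V k : {set {set I}} := [set T : {set I} | (T \subset V) && (#|T| == k)].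
Definition link z F := [set T : {set I} | (z \notin T) && (z |: T \in F)].
Definition deletion z F := [set T in F | z \notin T].

Lemma card_ksub V k : #|ksub V k| = 'C(#|V|, k).
Proof. by rewrite /ksub -cards_draws. Qed.

Lemma upcU1 x z S : z \notin S -> upc x (z |: S) = (x <= rho z) + upc x S.
Proof. by move=> zS; rewrite /upc big_setU1. Qed.

Lemma upc_le x S : upc x S <= #|S|.
Proof. by rewrite /upc -sum1_card leq_sum // => i _; exact: leq_b1. Qed.

Lemma upc_all x S : {in S, forall s, x <= rho s} -> upc x S = #|S|.
Proof. by move=> h; rewrite /upc -sum1_card; apply: eq_bigr => s /h ->. Qed.

Lemma upc_none x S : {in S, forall s, rho s < x} -> upc x S = 0.
Proof. by move=> h; rewrite /upc big1 // => s /h; case: leqP => //; lia. Qed.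

Lemma upcD x V S : S \subset V -> upc x (V :\: S) = upc x V - upc x S.
Proof.
move=> sSV; rewrite /upc (big_setID S (A := V)) /=.
by rewrite (setIidPr sSV) addKn.
Qed.

Lemma upc_card x S : upc x S = #|[set s in S | x <= rho s]|.
Proof.
rewrite /upc -sum1_card big_mkcond [RHS]big_mkcond /=; apply: eq_bigr => s _.
by rewrite inE; case: (s \in S); case: (x <= rho s).
Qed.

Lemma card_link_deletion z F : #|F| = #|link z F| + #|deletion z F|.
Proof.
rewrite -(cardsID [set S : {set I} | z \in S] F); congr (_ + _).
  rewrite -(card_in_imset (f := fun T : {set I} => z |: T) (D := link z F)).
    apply: eq_card => S; rewrite !inE; apply/andP/imsetP => [[SF zS]|[T]].
      by exists (S :\ z); rewrite ?inE ?eqxx /= setD1K.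
    by rewrite inE => /andP[zT TF] ->; rewrite TF !inE eqxx.
  move=> T1 T2; rewrite !inE => /andP[z1 _] /andP[z2 _] e.
  by rewrite -(setU1K z1) e setU1K.
by apply: eq_card => S; rewrite !inE andbC.
Qed.

Lemma ksub_link z V k F : z \in V -> F \subset ksub V k.+1 ->
  link z F \subset ksub (V :\ z) k.
Proof.
move=> zV sF; apply/subsetP => T; rewrite inE => /andP[zT] /(subsetP sF).
rewrite !inE cardsU1 zT add1n eqSS => /andP[sTV ->].
by rewrite subsetD1 zT (subset_trans (subsetUr _ _) sTV).
Qed.

Lemma ksub_deletion z V k F : F \subset ksub V k -> deletion z F \subset ksub (V :\ z) k.
Proof.
move=> sF; apply/subsetP => T; rewrite inE => /andP[/(subsetP sF)].
by rewrite !inE subsetD1 => /andP[-> ->] ->.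
Qed.

Lemma antichain_sub F A : A \subset F -> antichain F -> antichain A.
Proof. by move=> /subsetP s aF S T /s SF /s TF; apply: aF. Qed.

Lemma antichain_deletion z F : antichain F -> antichain (deletion z F).
Proof. by apply: antichain_sub; apply/subsetP => S; rewrite inE => /andP[]. Qed.

Lemma antichain_link z F : antichain F -> antichain (link z F).
Proof.
move=> aF S T; rewrite !inE => /andP[zS SF] /andP[zT TF] d.
rewrite -(setU1K zS) (aF _ _ SF TF) ?setU1K // => x.
by rewrite !upcU1 // leq_add2l.
Qed.

Definition cofam V F := [set V :\: S | S in F].

(** Tail counts of [V :\: S] are those of [V] minus those of [S], so complementation reverses [dom]
    and preserves antichains. This reduces large [k] to small [k]. *)
Lemma cofamP V k F : k <= #|V| -> F \subset ksub V k -> antichain F ->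
  [/\ cofam V F \subset ksub V (#|V| - k), antichain (cofam V F) & #|cofam V F| = #|F|].
Proof.
move=> kV sF aF; have sV S : S \in F -> S \subset V.
  by move/(subsetP sF); rewrite inE => /andP[].
split.
- apply/subsetP => _ /imsetP[S SF ->].
  move/(subsetP sF): SF; rewrite !inE subsetDl cardsD => /andP[sSV /eqP <-].
  by rewrite (setIidPr sSV) eqxx.
- move=> _ _ /imsetP[S SF ->] /imsetP[T TF ->] d.
  congr (_ :\: _); apply: esym; apply: aF => // x.
  have := d x; rewrite !upcD ?sV //.
  have h U : U \in F -> upc x U <= upc x V.
    by move=> UF; rewrite /upc (big_setID U (A := V)) /= (setIidPr (sV _ UF)) leq_addr.
  by have := h _ SF; have := h _ TF; lia.
- rewrite card_in_imset // => S T SF TF e.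
  have K U : U \in F -> V :\: (V :\: U) = U.
    by move=> UF; rewrite setDDr setDv set0U (setIidPr (sV _ UF)).
  by rewrite -(K _ SF) e K.
Qed.

(** Counts the pairs of a member [S] and an element [z] of it, grouped by [T = S :\ z]. *)
Lemma double_count V j F : F \subset ksub V j.+1 ->
  j.+1 * #|F| = \sum_(T in ksub V j) #|[set z in V :\: T | z |: T \in F]|.
Proof.
move=> sF.
have -> : j.+1 * #|F| = \sum_(S in F) \sum_(z in S) 1.
  rewrite mulnC -sum_nat_const; apply: eq_bigr => S /(subsetP sF).
  by rewrite inE sum1_card => /andP[_ /eqP ->].
transitivity (\sum_z \sum_(S in F | z \in S) 1).
  rewrite (exchange_big_dep xpredT) //=.
transitivity (\sum_z \sum_(T in ksub V j | (z \in V :\: T) && (z |: T \in F)) 1).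
  apply: eq_bigr => z _.
  rewrite (reindex_onto (fun T => z |: T) (fun S => S :\ z)) /=; last first.
    by move=> S /andP[_ zS]; rewrite setD1K.
  apply: eq_bigl => T; rewrite setU11 andbT !inE.
  case zT: (z \in T) => /=.
    rewrite andbF; apply/negbTE; rewrite negb_and orbC; apply/orP; left.
    apply/eqP => e; have := setD11 z (z |: T); rewrite e.
    by rewrite zT.
  rewrite setU1K ?zT // eqxx andbT.
  case TF: (z |: T \in F); rewrite ?andbF //= andbT.
  move/(subsetP sF): TF; rewrite inE cardsU1 zT subUset sub1set add1n eqSS.
  by case/andP => /andP[-> ->] ->.
rewrite (exchange_big_dep (fun T => T \in ksub V j)) /=; last by move=> ? ? _ /andP[].
apply: eq_bigr => T TV; rewrite -sum1_card; apply: eq_bigl => z.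
by rewrite TV !inE.
Qed.


(** * Ranks and involutions *)

Definition rk Z z := #|[set y in Z | rho z < rho y]|.

(** Ranks start at 0 from the top, as [upc] counts from above: the elements of height at least [x]
    occupy exactly the first [upc x Z] ranks. *)
Lemma rk_upc Z z x : z \in Z -> (x <= rho z) = (rk Z z < upc x Z).
Proof.
move=> zZ; rewrite upc_card /rk; case: (leqP x (rho z)) => [xz|zx]; apply/esym.
  apply/idP; apply: proper_card; apply/properP; split.
    by apply/subsetP => y; rewrite !inE => /andP[-> h] /=; lia.
  by exists z; rewrite !inE zZ ?ltnn //= .
apply/negbTE; rewrite -leqNgt; apply: subset_leq_card.
by apply/subsetP => y; rewrite !inE => /andP[-> h] /=; lia.
Qed.

Lemma rk_inj Z : {in Z &, injective (rk Z)}.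
Proof.
move=> y z yZ zZ e; apply: rho_inj; apply/eqP; rewrite eqn_leq.
by rewrite (rk_upc _ zZ) -e -rk_upc // leqnn (rk_upc _ yZ) e -rk_upc // leqnn.
Qed.

Lemma rk_ltn Z z : z \in Z -> rk Z z < #|Z|.
Proof. by move=> zZ; apply: leq_trans (upc_le (rho z) Z); rewrite -rk_upc. Qed.

Lemma rk_surj Z i : i < #|Z| -> exists2 z, z \in Z & rk Z z = i.
Proof.
(* [inord] lands in a successor type, which has one index too many; the image is everything but
   [ord_max]. *)
move=> iZ; pose f (z : I) : 'I_(#|Z|.+1) := inord (rk Z z).
have fE z : z \in Z -> f z = rk Z z :> nat.
  by move=> zZ; rewrite /f inordK // ltnS ltnW // rk_ltn.
have finj : {in Z &, injective f}.
  by move=> y z yZ zZ /(congr1 val) /=; rewrite !fE //; apply: rk_inj.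
have : f @: Z = [set~ ord_max].
  apply/eqP; rewrite eqEcard; apply/andP; split.
    apply/subsetP => _ /imsetP[z zZ ->]; rewrite !inE -val_eqE /= fE //.
    by have := rk_ltn zZ; lia.
  by rewrite cardsC1 card_ord card_in_imset.
move/setP/(_ (inord i)); rewrite !inE -val_eqE /= inordK ?(leqW iZ) //.
have -> : (i != #|Z|) = true by lia.
case/imsetP=> z zZ /(congr1 val) /=; rewrite fE // inordK ?(leqW iZ) // => e.
by exists z.
Qed.

(** Since [g] fixes nothing, it exchanges the points it moves up with the points it moves down. *)
Lemma even_invol (X : {set I}) (g : I -> I) :
  {in X, forall z, g z \in X} -> {in X, forall z, g (g z) = z} ->
  {in X, forall z, g z != z} -> ~~ odd #|X|.
Proof.
move=> gX gK gN; rewrite -(cardsID [set z | rho z < rho (g z)] X).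
suff -> : X :\: [set z | rho z < rho (g z)] = g @: (X :&: [set z | rho z < rho (g z)]).
  rewrite card_in_imset ?addnn ?odd_double // => y z.
  rewrite !inE => /andP[yX _] /andP[zX _] e.
  by rewrite -(gK _ yX) e gK.
apply/setP => z; rewrite !inE; apply/andP/imsetP => [[h zX]|[y]].
  exists (g z); rewrite ?gK // !inE gX // gK //.
  have := gN _ zX; rewrite -(inj_eq rho_inj); move: h; lia.
rewrite !inE => /andP[yX h] ->; rewrite gX // gK //; split=> //; lia.
Qed.

(** [g] carries the elements above [z] onto those below [g z]; together with [g z] and the elements
    above it they exhaust [X]. *)
Lemma rev_rank (X : {set I}) (g : I -> I) :
  {in X, forall z, g z \in X} -> {in X, forall z, g (g z) = z} ->
  {in X &, forall z y, rho z < rho y -> rho (g y) < rho (g z)} ->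
  {in X, forall z, (rk X z + rk X (g z)).+1 = #|X|}.
Proof.
move=> gX gK gR z zX.
have -> : rk X z = #|[set y in X | rho y < rho (g z)]|.
  rewrite /rk -(card_in_imset (f := g)).
    apply: eq_card => y; rewrite !inE; apply/imsetP/andP => [[u]|[yX h]].
      by rewrite !inE => /andP[uX h] ->; rewrite gX //; split => //; apply: gR.
    exists (g y); rewrite ?gK // inE gX //=.
    by have := gR _ _ yX (gX _ zX) h; rewrite gK.
  by move=> y u; rewrite !inE => /andP[yX _] /andP[uX _] e; rewrite -(gK _ yX) e gK.
rewrite (cardsD1 (g z) X) gX // add1n; congr _.+1.
rewrite -(cardsID [set y | rho y < rho (g z)] (X :\ g z)); congr (_ + _).
  apply: eq_card => y; rewrite !inE -(inj_eq rho_inj) /=.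
  by case: (y \in X); rewrite ?andbT ?andbF //= ; lia.
apply: eq_card => y; rewrite !inE -(inj_eq rho_inj) /=.
by case: (y \in X); rewrite ?andbT ?andbF //= ; lia.
Qed.

(** * Two mutually incomparable antichains *)

Section Crossing.
Variables (V : {set I}) (j : nat) (A B : {set {set I}}).
Hypotheses (sA : A \subset ksub V j.+1) (sB : B \subset ksub V j.+1).
Hypotheses (aA : antichain A) (aB : antichain B).
(* If [a] lies below and [b] above all of [V], this says that [a |: S] and
   [b |: T] are never related by [dom]. *)
Hypothesis crossAB : {in A & B, forall S T, ~ (forall x, upc x S <= (upc x T).+1)}.

Let D := A :|: B.

Lemma crossing_disjoint : #|D| = #|A| + #|B|.
Proof.
rewrite cardsU; have -> : A :&: B = set0; last by rewrite cards0 subn0.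
apply/setP => S; rewrite !inE; apply/negbTE/negP => /andP[SA SB].
by apply: (crossAB SA SB) => x; rewrite leqnSn.
Qed.

Lemma crossing_sub : D \subset ksub V j.+1.
Proof. by rewrite subUset sA. Qed.

(** For fixed [T] the sets [z |: T] form a chain under [dom], ordered by [rho z]. *)
Lemma antichain_ext F T z y : antichain F -> z \notin T -> y \notin T ->
  z |: T \in F -> y |: T \in F -> z = y.
Proof.
move=> aF; wlog h : z y / rho z <= rho y => [H|] zT yT zF yF.
  by case: (leqP (rho z) (rho y)) => [|/ltnW] h; [|apply: esym]; apply: H.
have /setP/(_ z) : z |: T = y |: T.
  apply: aF => // x; rewrite !upcU1 // leq_add2r.
  by case: (leqP x (rho z)) => // xz; rewrite (leq_trans xz h).
by rewrite !inE eqxx (negbTE zT) /= orbF => /esym/eqP.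
Qed.

(** Two one-point extensions of the same [T] have tail counts differing by at most one, which
    [crossAB] forbids. *)
Lemma crossing_ext_sep T z y : z \notin T -> y \notin T ->
  z |: T \in A -> y |: T \in B -> False.
Proof.
move=> zT yT zA yB; apply: (crossAB zA yB) => x; rewrite !upcU1 //.
by rewrite -add1n leq_add ?leq_b1 // leq_addl.
Qed.

Lemma crossing_ext T z y : z \notin T -> y \notin T ->
  z |: T \in D -> y |: T \in D -> z = y.
Proof.
move=> zT yT; rewrite !inE => /orP[] zD /orP[] yD.
- exact: (antichain_ext aA zT yT zD yD).
- by case: (crossing_ext_sep zT yT zD yD).
- by case: (crossing_ext_sep yT zT yD zD).
- exact: (antichain_ext aB zT yT zD yD).
Qed.

Definition bad := [set T in ksub V j | [forall z in V :\: T, z |: T \notin D]].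

(** Double counting: each [T] of size [j] has exactly one extension in [D], or none and is bad. *)
Lemma crossing_count : j.+1 * #|D| + #|bad| = 'C(#|V|, j).
Proof.
rewrite (double_count crossing_sub) -card_ksub -(cardsID bad (ksub V j)) addnC.
congr (_ + _).
  by apply: eq_card => T; rewrite !inE; case: (_ && (_ == _)).
rewrite -sum1_card (big_setID bad (A := ksub V j)) /= big1 ?add0n.
  apply: eq_bigr => T /setDP[TV]; rewrite inE TV /= negb_forall_in.
  case/exists_inP => z zT; rewrite negbK => zD; apply/eqP/cards1P; exists z.
  apply/setP => y; rewrite in_set1 inE.
  apply/andP/eqP => [[yT yD]|->]; last by split.
  by move: yT zT; rewrite !inE => /andP[yT _] /andP[zT _]; apply: crossing_ext yD zD.
move=> T /setIP[_]; rewrite inE => /andP[_ /forall_inP h].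
by apply: eq_card0 => z; rewrite inE; apply/negP => /andP[zT zD]; case/negP: (h z zT).
Qed.

Lemma crossing_bound : j.+1 * (#|A| + #|B|) <= 'C(#|V|, j).
Proof. by rewrite -crossing_disjoint -crossing_count leq_addr. Qed.

(** * Pairing the one-point extensions of a set *)

Definition partner (T : {set I}) z :=
  odflt z [pick y in V :\: T | (y != z) && (y |: (z |: T) \in D)].
Definition matched (T : {set I}) := [set z in V :\: T | z |: T \notin bad].
(** In the application [A] consists of the sets completed by the minimum. When all of [V :\: T] is
    matched, the points of [lowpart T] lie above the remaining ones. *)
Definition lowpart (T : {set I}) :=
  [set z in V :\: T | partner T z |: (z |: T) \in A].

Section Partner.
Variables (j0 : nat) (T : {set I}).
Hypotheses (j0E : j = j0.+1) (TV : T \in ksub V j0).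

(** The default value of [partner T z] is [z] itself; it does not occur here, since [z |: T] is not
    bad and so has an extension in [D]. *)
Lemma partnerP z : z \in matched T ->
  [/\ partner T z \in V :\: T, partner T z != z & partner T z |: (z |: T) \in D].
Proof.
rewrite inE => /andP[zVT zb]; rewrite /partner; case: pickP => [y /and3P[]//|no].
case/negP: zb; rewrite inE; move: TV zVT; rewrite !inE => /andP[sTV cT] /andP[zT zV].
rewrite subUset sub1set zV sTV cardsU1 zT (eqP cT) j0E add1n eqxx /=.
apply/forall_inP => y; rewrite !inE negb_or => /andP[/andP[yz yT] yV].
by have := no y; rewrite !inE yT yV yz /= => ->.
Qed.

Lemma partner_eq z y : z \in V :\: T -> y \in V :\: T -> y != z ->
  y |: (z |: T) \in D -> partner T z = y /\ z \in matched T.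
Proof.
move=> zV yV yz yD.
have zm : z \in matched T.
  rewrite inE zV inE negb_and; apply/orP; right.
  rewrite negb_forall_in; apply/exists_inP; exists y; last by rewrite negbK.
  by move: yV; rewrite !inE negb_or yz => /andP[-> ->].
split=> //; have [pV pz pD] := partnerP zm.
by apply: crossing_ext pD yD; rewrite !inE negb_or ?pz ?yz;
  [case/setDP: pV|case/setDP: yV].
Qed.

Lemma partner_matched z : z \in matched T ->
  partner T z \in matched T /\ partner T (partner T z) = z.
Proof.
move=> zm; have [pV pz pD] := partnerP zm.
have zV : z \in V :\: T by move: zm; rewrite inE => /andP[].
have [] := @partner_eq (partner T z) z pV zV; rewrite 1?eq_sym //.
by rewrite setUCA.
Qed.

Lemma odd_matched : ~~ odd #|matched T|.
Proof.
apply: (@even_invol _ (partner T)) => z zm; have [h1 h2] := partner_matched zm => //.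
by have [] := partnerP zm.
Qed.

Lemma lowpart_partner z : z \in matched T ->
  (partner T z \in lowpart T) = (z \in lowpart T).
Proof.
move=> zm; have [h1 h2] := partner_matched zm; have [pV pz pD] := partnerP zm.
have zV : z \in V :\: T by move: zm; rewrite inE => /andP[].
by rewrite ![_ \in lowpart _]inE pV zV h2 setUCA.
Qed.

Hypothesis perfT : matched T = V :\: T.

Let Z := V :\: T.
Let g := partner T.
Let L := lowpart T.

Lemma perfect_partnerP z : z \in Z -> [/\ g z \in Z, g z != z, g (g z) = z &
  g z |: (z |: T) \in if z \in L then A else B].
Proof.
move=> zZ; have zm : z \in matched T by rewrite perfT.
have [h1 h2] := partner_matched zm; have [pV pz pD] := partnerP zm.
split=> //; rewrite [z \in L]inE zZ /=.
by move: pD; rewrite inE; case: ifP.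
Qed.

Lemma upc_pair x z : z \in Z -> upc x (g z |: (z |: T)) =
  (x <= rho (g z)) + ((x <= rho z) + upc x T).
Proof.
move=> zZ; have [gZ gz _ _] := perfect_partnerP zZ.
rewrite !upcU1 //; first by move: zZ; rewrite inE => /andP[].
by move: gZ; rewrite !inE (negbTE gz) => /andP[].
Qed.

(** If [z] were not above [y], the counts of [z |: T] would be at most those of [y |: T]. Adding the
    partner of [z] costs at most one more, contradicting [crossAB]. *)
Lemma lowpart_above z y : z \in L -> y \in Z :\: L -> rho y < rho z.
Proof.
move=> zL /setDP[yZ yL]; rewrite ltnNge; apply/negP => zy.
have zZ : z \in Z by move: zL; rewrite inE => /andP[].
have [gz _ _] := perfect_partnerP zZ; have [gy _ _] := perfect_partnerP yZ.
rewrite zL (negbTE yL) => SB SA; apply: (crossAB SA SB) => x.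
rewrite !upc_pair //.
apply: (@leq_trans (1 + ((x <= rho y) + upc x T))).
  by rewrite leq_add ?leq_b1 // leq_add ?leq_indic.
by rewrite add1n ltnS leq_addl.
Qed.

(** If both the points and their partners were in the same order, the two pairs would be comparable,
    hence equal; then [y = g z] and [g y = z], against the order. *)
Lemma partner_rev F z y : antichain F -> z \in Z -> y \in Z ->
  g z |: (z |: T) \in F -> g y |: (y |: T) \in F ->
  rho z < rho y -> rho (g y) < rho (g z).
Proof.
move=> aF zZ yZ zF yF zy; rewrite ltnNge; apply/negP => gzy.
have e : g z |: (z |: T) = g y |: (y |: T).
  by apply: aF => // x; rewrite !upc_pair // leq_add ?leq_indic // leq_add ?leq_indic // ltnW.
have : y \in g z |: (z |: T) by rewrite e !inE eqxx orbT.
have yT : y \notin T by move: yZ; rewrite inE => /andP[].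
rewrite !inE (negbTE yT) orbF => /orP[/eqP yg|/eqP yz]; last by move: zy; rewrite yz ltnn.
by move: gzy; rewrite [in g y]yg; have [_ _ -> _] := perfect_partnerP zZ; rewrite -yg leqNgt zy.
Qed.

Lemma lowpart_sub : L \subset Z.
Proof. by apply/subsetP => z; rewrite inE => /andP[]. Qed.

Lemma odd_lowpart : ~~ odd #|L|.
Proof.
apply: (@even_invol _ g) => z zL; have zZ := subsetP lowpart_sub _ zL;
  have [h1 h2 h3 _] := perfect_partnerP zZ => //.
by rewrite /L lowpart_partner // perfT.
Qed.

Lemma rk_lowpart z : z \in Z -> (z \in L) = (rk Z z < #|L|).
Proof.
move=> zZ; case zL: (z \in L); apply/esym.
  apply: leq_ltn_trans (rk_ltn zL); apply: subset_leq_card.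
  apply/subsetP => y; rewrite in_set => /andP[yZ zy]; rewrite in_set zy andbT.
  apply/negPn/negP => yL; have := @lowpart_above z y zL.
  by rewrite in_setD yL yZ => /(_ isT); lia.
apply/negbTE; rewrite -leqNgt; apply: subset_leq_card.
apply/subsetP => y yL; rewrite in_set (subsetP lowpart_sub) //=.
by apply: lowpart_above => //; rewrite in_setD zL.
Qed.

(** [g] reverses the order on [L], the top block of [Z], and on the block below it, where ranks are
    shifted by [#|L|]. So the rank of [z] and [#|L|] determine the rank of its partner. *)
Lemma rk_partner z : z \in Z ->
  (rk Z z + rk Z (g z)).+1 = #|L| + (z \notin L) * #|Z|.
Proof.
move=> zZ; case zL: (z \in L) => /=.
  rewrite mul0n addn0 -(@rev_rank L g _ _ _ z) //.
  - have e y : y \in L -> rk Z y = rk L y.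
      move=> yL; apply: eq_card => u; rewrite in_set [RHS]in_set.
      case: (ltnP (rho y) (rho u)) => yu; rewrite ?andbT ?andbF //.
      apply/idP/idP => [uZ|/(subsetP lowpart_sub)//].
      apply/negPn/negP => uL; have := @lowpart_above y u yL.
      by rewrite in_setD uL uZ => /(_ isT); lia.
    by rewrite !e // /L lowpart_partner // perfT.
  - by move=> y yL; rewrite /L lowpart_partner // perfT (subsetP lowpart_sub).
  - by move=> y yL; have [] := perfect_partnerP (subsetP lowpart_sub _ yL).
  - move=> y u yL uL; have yZ := subsetP lowpart_sub _ yL; have uZ := subsetP lowpart_sub _ uL.
    have [_ _ _] := perfect_partnerP yZ; have [_ _ _] := perfect_partnerP uZ; rewrite yL uL => h1 h2.
    exact: (partner_rev aA).
rewrite mul1n; have cZ := cardsID L Z; rewrite (setIidPr lowpart_sub) in cZ.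
have e y : y \in Z :\: L -> rk Z y = #|L| + rk (Z :\: L) y.
  move=> yU; rewrite /rk -(cardsID L); congr (_ + _).
    apply: eq_card => u; rewrite in_setI in_set.
    case uL: (u \in L); rewrite ?andbF // (subsetP lowpart_sub) // andbT.
    exact: lowpart_above.
  by apply: eq_card => u; rewrite in_setD in_set [RHS]in_set in_setD andbA.
have zU : z \in Z :\: L by rewrite in_setD zL.
have gU y : y \in Z :\: L -> g y \in Z :\: L.
  case/setDP=> yZ yL; have [gZ _ _ _] := perfect_partnerP yZ.
  by rewrite in_setD gZ /L lowpart_partner ?perfT // yL.
rewrite e // e ?gU //.
suff : (rk (Z :\: L) z + rk (Z :\: L) (g z)).+1 = #|Z :\: L| by lia.
apply: rev_rank => //.
  by move=> y /setDP[yZ _]; have [] := perfect_partnerP yZ.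
move=> y u /setDP[yZ yL] /setDP[uZ uL].
have [_ _ _] := perfect_partnerP yZ; have [_ _ _] := perfect_partnerP uZ.
rewrite (negbTE yL) (negbTE uL) => h1 h2.
exact: (partner_rev aB).
Qed.

End Partner.

Lemma ksubU1 (R : {set I}) k t : R \in ksub V k -> t \in V :\: R -> t |: R \in ksub V k.+1.
Proof.
rewrite !inE => /andP[sR /eqP cR] /andP[tR tV].
by rewrite subUset sub1set tV sR cardsU1 tR cR add1n eqxx.
Qed.

(* Comparing elements of equal rank in [V :\: (t |: R)] and [V :\: (t' |: R)]
   produces two sets of the same antichain related by [dom]. *)
Lemma lowpart_neq j1 (R : {set I}) t t' : j = j1.+2 -> R \in ksub V j1 ->
  j1.+3 < #|V| -> t \in V :\: R -> t' \in V :\: R -> rho t < rho t' ->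
  matched (t |: R) = V :\: (t |: R) -> matched (t' |: R) = V :\: (t' |: R) ->
  #|lowpart (t |: R)| <> #|lowpart (t' |: R)|.
Proof.
move=> jE RV cV tV t'V tt' pt pt' eL.
have Tk := ksubU1 RV tV; have Tk' := ksubU1 RV t'V.
set T := t |: R in pt eL Tk; set T' := t' |: R in pt' eL Tk'.
pose Z := V :\: T; pose Z' := V :\: T'.
have cZ : #|Z| = #|V| - j1.+1 /\ #|Z'| = #|V| - j1.+1.
  move: Tk Tk'; rewrite !inE => /andP[s1 /eqP c1] /andP[s2 /eqP c2].
  by rewrite !cardsD (setIidPr s1) (setIidPr s2) c1 c2.
have t'Z : t' \in Z.
  move: t'V; rewrite !in_setD => /andP[h ->]; rewrite andbT /T in_setU1 negb_or h andbT.
  by apply/eqP => e; move: tt'; rewrite e ltnn.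
have [gt'Z gt'n gt'K _] := perfect_partnerP jE Tk pt t'Z.
(* [Z] has at least three elements, so one is left beside [t'] and its partner; its pair avoids
   [t']. *)
have : 0 < #|Z :\ t' :\ partner T t'|.
  have := cardsD1 (partner T t') (Z :\ t'); have := cardsD1 t' Z.
  rewrite in_setD1 gt'n gt'Z t'Z (proj1 cZ); move: cV; move: #|_| #|_| #|_|; clear; lia.
case/card_gt0P => z; rewrite !in_setD1 => /and3P[zg zt' zZ].
have [z' z'Z rz] : exists2 z', z' \in Z' & rk Z' z' = rk Z z.
  by apply: rk_surj; rewrite (proj2 cZ) -(proj1 cZ) rk_ltn.
have [gzZ gzn gzK SF] := perfect_partnerP jE Tk pt zZ.
have [gz'Z gz'n gz'K SF'] := perfect_partnerP jE Tk' pt' z'Z.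
have zL : (z' \in lowpart T') = (z \in lowpart T).
  by rewrite (rk_lowpart jE Tk pt zZ) (rk_lowpart jE Tk' pt' z'Z) rz eL.
have rg : rk Z' (partner T' z') = rk Z (partner T z).
  have := rk_partner jE Tk' pt' z'Z.
  rewrite zL -eL -/Z' (proj2 cZ) -(proj1 cZ) -(rk_partner jE Tk pt zZ) rz.
  by move/succn_inj/addnI.
have rn : rk Z z <> rk Z (partner T z).
  by move/(rk_inj zZ gzZ) => e; rewrite -e eqxx in gzn.
have eS : partner T z |: (z |: T) = partner T' z' |: (z' |: T').
  rewrite zL in SF'.
  have aF : antichain (if z \in lowpart T then A else B) by case: ifP.
  apply: aF => // x.
  (* Through the equal ranks both sides take the form of [leq_shifted_indic]; its bit records
     whether [t], respectively [t'], has height at least [x]. *)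
  rewrite (upc_pair jE Tk pt x zZ) (upc_pair jE Tk' pt' x z'Z).
  rewrite (rk_upc x gzZ) (rk_upc x zZ) (rk_upc x gz'Z) (rk_upc x z'Z).
  rewrite -/Z -/Z' rz rg /T /T' !upcU1; try by move: tV t'V; rewrite !inE => /andP[? _] /andP[? _].
  have uZ u : u \in V :\: R -> upc x (V :\: (u |: R)) = upc x (V :\: R) - (x <= rho u).
    move=> uV; rewrite setUC -setDDl upcD ?sub1set //.
    by rewrite [upc x [set u]]/upc big_set1.
  by rewrite !uZ //; apply: leq_shifted_indic; [exact: rn|apply: leq_indic; apply: ltnW].
have : t' \in partner T z |: (z |: T) by rewrite eS !inE eqxx !orbT.
have t'R : t' \notin R by move: t'V; rewrite inE => /andP[].
rewrite !inE (negbTE t'R) orbF => /or3P[/eqP e|/eqP e|/eqP e].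
- by move: zg; rewrite e gzK eqxx.
- by rewrite e eqxx in zt'.
- by move: tt'; rewrite e ltnn.
Qed.

Definition perfect k := [set T in ksub V k | matched T == V :\: T].

(** Distinct [t] give distinct values of [#|lowpart (t |: R)|], and these are even and at most
    [#|V| - j1.+1]. *)
Lemma card_perfect j1 (R : {set I}) : j = j1.+2 -> R \in ksub V j1 -> j1.+3 < #|V| ->
  #|[set t in V :\: R | t |: R \in perfect j1.+1]| <= ((#|V| - j1.+1)./2).+1.
Proof.
move=> jE RV cV; set X := [set _ in _ | _].
pose f t : 'I_((#|V| - j1.+1)./2).+1 := inord (#|lowpart (t |: R)|./2).
have pX t : t \in X -> [/\ t \in V :\: R, t |: R \in ksub V j1.+1 &
    matched (t |: R) = V :\: (t |: R)].
  by rewrite !in_set => /andP[tV /andP[h /eqP]]; split; rewrite ?in_setD // inE.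
have fE t : t \in X -> (f t).*2 = #|lowpart (t |: R)|.
  case/pX => tV Tk pt; have := odd_lowpart jE Tk pt; have := subset_leq_card (lowpart_sub (t |: R)).
  have -> : #|V :\: (t |: R)| = #|V| - j1.+1.
    by move: Tk; rewrite inE => /andP[s /eqP c]; rewrite cardsD (setIidPr s) c.
  move=> h1 h2; rewrite /f inordK ?ltnS ?half_leq //.
  by rewrite -[RHS]odd_double_half (negbTE h2).
rewrite -[X in _ <= X]card_ord -(card_in_imset (f := f) (D := X)); first exact: max_card.
move=> t t' tX t'X e; have [tV _ pt] := pX _ tX; have [t'V _ pt'] := pX _ t'X.
have eL : #|lowpart (t |: R)| = #|lowpart (t' |: R)| by rewrite -!fE // e.
apply/eqP; rewrite -(inj_eq rho_inj).
case: (ltngtP (rho t) (rho t')) => // h; exfalso.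
  exact: (lowpart_neq jE RV cV tV t'V h pt pt').
exact: (lowpart_neq jE RV cV t'V tV h pt' pt (esym eL)).
Qed.

Lemma bad_sub : bad \subset ksub V j.
Proof. by apply/subsetP => T; rewrite inE => /andP[]. Qed.

Lemma card_bad_ext j0 (T : {set I}) : j = j0.+1 -> T \in ksub V j0 ->
  #|[set z in V :\: T | z |: T \in bad]| + #|matched T| = #|V| - j0.
Proof.
move=> jE TV; have -> : #|V| - j0 = #|V :\: T|.
  by move: TV; rewrite inE => /andP[s /eqP c]; rewrite cardsD (setIidPr s) c.
rewrite -(cardsID [set z | z |: T \in bad] (V :\: T)); congr (_ + _).
  by apply: eq_card => z; rewrite in_setI !in_set.
by apply: eq_card => z; rewrite in_setD !in_set andbC.
Qed.

(** The bad sets are counted through their subsets [T] of size [j - 1], whose complement in [V] has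
    [j + 4] points. *)
Lemma bad_lower j0 : j = j0.+1 -> #|V| = j.*2.+3 -> 'C(#|V|, j) <= #|V| * #|bad|.
Proof.
move=> jE cV.
have dc : j0.+1 * #|bad| = \sum_(T in ksub V j0) #|[set z in V :\: T | z |: T \in bad]|.
  by apply: double_count; rewrite -jE bad_sub.
have c01 : j * 'C(#|V|, j) = (j + 4) * 'C(#|V|, j0).
  by rewrite jE mul_bin_left cV jE; congr (_ * _); lia.
have cN : #|V| - j0 = j + 4 by lia.
case oj: (odd j).
  (* [j + 4] is odd and evenly many points are matched, so each [T] has a bad extension. *)
  have : 'C(#|V|, j0) <= j * #|bad|.
    rewrite {1}jE dc -card_ksub -sum1_card leq_sum // => T TV.
    apply: odd_addn_gt0 (odd_matched jE TV) (card_bad_ext jE TV).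
    by rewrite cN oddD oj.
  move=> h; rewrite -(leq_pmul2l (ltn0Sn j0)) -{1}jE c01.
  apply: (@leq_trans ((j + 4) * (j * #|bad|))); first by rewrite leq_mul2l h orbT.
  by rewrite mulnCA jE leq_mul2l /= leq_mul2r cV jE; apply/orP; right; clear; lia.
case: j0 jE dc c01 cN => [|j1] jE dc c01 cN; first by rewrite jE in oj.
have c12 : j1.+1 * 'C(#|V|, j1.+1) = (j + 5) * 'C(#|V|, j1).
  by rewrite mul_bin_left cV jE; congr (_ * _); lia.
(* For each [R] at most [(j + 4) / 2 + 1] of the sets [t |: R] are perfect. *)
have hp : 2 * (j1.+1 * #|perfect j1.+1|) <= (j + 6) * 'C(#|V|, j1).
  rewrite (@double_count V); last by apply/subsetP => T; rewrite inE => /andP[].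
  rewrite mulnC -[X in _ <= X]mulnC -card_ksub -sum_nat_const big_distrl /= leq_sum // => R RV.
  have := card_perfect jE RV; rewrite cN cV jE => /(_ _).
  move: #|_|; clear; lia.
(* Now [j + 4] is even, so a [T] that is not perfect has at least two bad extensions. *)
have hb : 2 * 'C(#|V|, j1.+1) <= j * #|bad| + 2 * #|perfect j1.+1|.
  rewrite {1}jE dc -card_ksub.
  have -> : #|perfect j1.+1| = \sum_(T in ksub V j1.+1) (matched T == V :\: T).
    rewrite -sum1_card big_mkcond [RHS]big_mkcond; apply: eq_bigr => T _.
    by rewrite [T \in perfect _]inE; case: (T \in ksub _ _); case: eqP.
  rewrite mulnC -sum_nat_const big_distrr -big_split leq_sum //= => T TV.
  have := card_bad_ext jE TV; have := odd_matched jE TV; rewrite cN.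
  case: eqP => [_|nT] /=; first by rewrite leq_addl.
  have : #|matched T| < #|V :\: T|.
    apply: proper_card; rewrite properEneq; apply/andP; split; first exact/eqP.
    by apply/subsetP => z; rewrite inE => /andP[].
  have -> : #|V :\: T| = #|V| - j1.+1.
    by move: TV; rewrite inE => /andP[s /eqP c]; rewrite cardsD (setIidPr s) c.
  rewrite cN muln0 addn0 => h1 h2 h3; apply: even_addn_gt1 h2 h3 h1.
  by rewrite oddD oj.
rewrite cV jE in c01 c12 hp hb *; exact: central_bad_ineq c01 c12 hp hb.
Qed.

Lemma crossing_bound_central j0 : j = j0.+1 -> #|V| = j.*2.+3 ->
  #|V| * (j.+1 * (#|A| + #|B|)) <= (#|V| - 1) * 'C(#|V|, j).
Proof.
move=> jE cV; have := bad_lower jE cV; have := crossing_count.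
rewrite crossing_disjoint; move: (_ * (_ + _)) #|bad| 'C(_, _) => x y c <-.
by rewrite mulnBl mul1n mulnDr; lia.
Qed.

End Crossing.

(** * Size of a single antichain *)

Lemma antichain_shadow V j F : F \subset ksub V j.+1 -> antichain F ->
  j.+1 * #|F| <= 'C(#|V|, j).
Proof.
(* The second family is taken empty, which makes the crossing condition vacuous. *)
move=> sF aF; rewrite -[#|F|]addn0 -(cards0 {set I}).
apply: crossing_bound; rewrite ?sub0set // => S T; by rewrite inE.
Qed.

(** Otherwise [b |: T] would dominate [a |: S]: both counts are full up to height [rho a], [b]
    supplies the missing one up to [rho b], and [a |: S] has nothing above. Equality is excluded
    since [a] is not in [b |: T]. *)
Lemma links_cross V j F a b : a \in V -> b \in V :\ a ->
  {in V, forall z, rho a <= rho z} -> {in V, forall z, rho z <= rho b} ->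
  F \subset ksub V j.+2 -> antichain F ->
  {in deletion b (link a F) & link b (deletion a F), forall S T, ~ (forall x, upc x S <= (upc x T).+1)}.
Proof.
move=> aV bV mina maxb sF aF S T; rewrite !inE => /andP[/andP[aS SF] bS].
case/and3P=> bT TF abT h.
have : a |: S = b |: T.
  apply: aF => // x; rewrite !upcU1 //.
  have [sSV cS] : S \subset V /\ #|S| = j.+1.
    move/(subsetP sF): SF; rewrite inE cardsU1 aS subUset add1n eqSS.
    by case/andP=> /andP[_ ->] /eqP ->.
  have [sTV cT] : T \subset V /\ #|T| = j.+1.
    move/(subsetP sF): TF; rewrite inE cardsU1 bT subUset add1n eqSS.
    by case/andP=> /andP[_ ->] /eqP ->.
  case: (leqP x (rho a)) => xa.
    rewrite !upc_all ?cS ?cT; first by rewrite (leq_trans xa) // mina; case/setD1P: bV.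
      by move=> s /(subsetP sTV)/mina; apply: leq_trans.
    by move=> s /(subsetP sSV)/mina; apply: leq_trans.
  case: (leqP x (rho b)) => xb; first by rewrite add0n add1n.
  by rewrite upc_none // => s /(subsetP sSV)/maxb h1; apply: leq_ltn_trans xb.
move/setP/(_ a); rewrite !inE eqxx /=; move: abT => /norP[/negbTE -> /negbTE ->].
by [].
Qed.

Lemma ex_extrema V : 1 < #|V| -> exists a b, [/\ a \in V, b \in V :\ a,
  {in V, forall z, rho a <= rho z} & {in V, forall z, rho z <= rho b}].
Proof.
case/card_gt1P => u [v [uV vV uv]].
case: (arg_minnP rho uV) => a aV mina; case: (arg_maxnP rho uV) => b bV maxb.
have {}bV : b \in V by [].
exists a, b; split=> //; rewrite in_setD1 bV andbT; apply/eqP => e.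
have eq z : z \in V -> z = a.
  move=> zV; apply: rho_inj; apply/eqP; rewrite eqn_leq mina // -{1}e andbT.
  exact: maxb.
by case/eqP: uv; rewrite (eq u uV) (eq v vV).
Qed.

Theorem antichain_odd m : forall V k F, #|V| = m.*2.+1 -> 0 < k < #|V| ->
  F \subset ksub V k -> antichain F -> #|V| * #|F| <= 'C(#|V|, k).
Proof.
elim: m => [|m IH] V k F cV; first by rewrite cV; case: k => [|[]].
(* Complements exchange [k] and [#|V| - k]. *)
wlog km : k F / k <= m.+1 => [H|] kV sF aF.
  case: (leqP k m.+1) => km; first exact: H.
  have kV' : k <= #|V| by case/andP: kV => _ /ltnW.
  have [s a c] := cofamP kV' sF aF.
  by rewrite -c -bin_sub //; apply: H => //; move: kV km; rewrite cV; clear; lia.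
have {}kV : 0 < k by case/andP: kV.
case: k km kV sF aF => [|[|[|j0]]] // km _ sF aF.
- by have := antichain_shadow sF aF; rewrite bin0 bin1 mul1n; case: #|F| => [|[]] //; rewrite ?muln0 ?muln1.
(* The shadow bound [2 * #|F| <= #|V|] is rounded down, [#|V|] being odd. *)
- have h : #|F| <= m.+1 by have := antichain_shadow sF aF; rewrite bin1 cV; clear; lia.
  by rewrite cV bin2 succnK -doubleMr doubleK leq_mul2l h orbT.
have V1 : 1 < #|V| by rewrite cV.
have [a [b [aV bV mina maxb]]] := ex_extrema V1.
pose V' := V :\ a :\ b.
have cV' : #|V'| = m.*2.+1.
  have := cardsD1 a V; have := cardsD1 b (V :\ a); rewrite aV bV cV /V'; move: #|_| #|_|; clear; lia.
pose F11 := link b (link a F); pose F00 := deletion b (deletion a F).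
pose A := deletion b (link a F); pose B := link b (deletion a F).
have cF : #|F| = #|F11| + #|F00| + (#|A| + #|B|).
  by rewrite (card_link_deletion a F) (card_link_deletion b (link a F)) (card_link_deletion b (deletion a F))
    -/F11 -/F00 -/A -/B; clear; lia.
have sl := ksub_link aV sF; have sd := ksub_deletion a sF.
have h11 : #|V'| * #|F11| <= 'C(#|V'|, j0.+1).
  apply: IH; rewrite ?cV' //; first by move: km; clear; lia.
    exact: ksub_link.
  by do 2!apply: antichain_link.
have h00 : #|V'| * #|F00| <= 'C(#|V'|, j0.+3).
  apply: IH; rewrite ?cV' //; first by move: km; clear; lia.
    exact: ksub_deletion.
  by do 2!apply: antichain_deletion.
have sA : A \subset ksub V' j0.+2 by apply: ksub_deletion.
have sB : B \subset ksub V' j0.+2 by apply: ksub_link.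
have aA : antichain A by apply: antichain_deletion; apply: antichain_link.
have aB : antichain B by apply: antichain_link; apply: antichain_deletion.
have cAB := links_cross aV bV mina maxb sF aF.
have hs := crossing_bound sA sB aA aB cAB.
have hc := crossing_bound_central sA sB aA aB cAB (erefl j0.+1).
have b1 := mul_bin_left #|V'| j0.+1; have b2 := mul_bin_left #|V'| j0.+2.
have bC : 'C(#|V|, j0.+3) = 'C(#|V'|, j0.+3) + 2 * 'C(#|V'|, j0.+2) + 'C(#|V'|, j0.+1).
  by rewrite cV cV' doubleS !binS; lia.
have bY : j0 = 0 -> 'C(#|V'|, j0.+1) = m.*2.+1 by move=> ->; rewrite bin1.
move: hc h11 h00 hs b1 b2 bY; rewrite cF bC cV cV'; move: km; clear.
move: #|A| #|B| #|F00| #|F11| => x y f00 f11; move: (x + y) => {x y} z.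
move: 'C(_, _) 'C(_, _) 'C(_, _) => X1 X2 Y km hc h11 h00 hs b1 b2 bY.
(* [s] is the distance of [k] from the middle [m.+1]; the bound through bad sets applies at
   [s = 0]. *)
have [s ms] : exists s, m = j0 + 2 + s by exists (m - (j0 + 2)); lia.
have NE : m.*2.+1 = j0.+2 + s.*2.+1 + j0.+2 by lia.
have e1 : j0.+2 * X1 = (j0.+2 + s.*2.+1).+1 * Y by rewrite b1; congr (_ * _); lia.
have e2 : j0.+3 * X2 = (j0.+2 + s.*2.+1) * X1 by rewrite b2; congr (_ * _); lia.
have -> : m.+1.*2.+1 = m.*2.+1 + 2 by lia.
case: (posnP s) => [s0|s_gt0].
  apply: (extrema_step_ineq _ _ _ h11 h00 _ e1 e2) => //.
    by apply: hc; lia.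
  by have := extrema_poly_central j0.+2; rewrite NE s0 /= addn1.
case: (posnP (j0 + s.-1)) => [js|js].
  (* Here n = 9 and k = 3, where the rational estimate is too weak and the
     bounds on [f00], [f11] and [z] must be rounded down. *)
  have {}ms : m = 3 by lia.
  have j00 : j0 = 0 by lia.
  move: (bY j00) h11 h00 hs b1 b2; rewrite ms j00 /=; lia.
apply: (extrema_step_ineq _ _ _ h11 h00 _ e1 e2 (c := m.*2.+1)) => //.
  by rewrite leq_mul2l hs orbT.
by have := @extrema_poly j0.+2 s; rewrite NE /=; apply; lia.
Qed.

Theorem antichain_even m V k F : #|V| = m.+1.*2 -> 0 < k < #|V| ->
  F \subset ksub V k -> antichain F -> (#|V| - 1) * #|F| <= 'C(#|V|, k).
Proof.
move=> cV kV sF aF.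
have [a aV] : exists a, a \in V by apply/card_gt0P; rewrite cV.
have cV' : #|V :\ a| = m.*2.+1 by move: (cardsD1 a V); rewrite aV cV; clear; lia.
have -> : #|V| - 1 = #|V :\ a| by rewrite cV cV'; clear; lia.
(* The deletion of [a] needs [k < #|V| - 1]. Complements reduce [k = #|V| - 1] to [k = 1]; for
   [#|V| = 2] these coincide and the shadow bound is used. *)
wlog k2 : k F kV sF aF / k < #|V|.-1 => [H|].
  case: (ltnP k #|V|.-1) => k2; first exact: H.
  have kV' : k <= #|V| by case/andP: kV => _ /ltnW.
  have [s a' c] := cofamP kV' sF aF.
  case: (leqP m 0) => m0; last first.
    by rewrite -c -bin_sub //; apply: H => //; move: kV k2 m0; rewrite cV; clear; lia.
  have k1 : k = 1 by move: kV k2; rewrite cV; move: m0; clear; lia.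
  move: sF; rewrite k1 => sF; have := antichain_shadow sF aF.
  by rewrite bin0 bin1 cV' cV; move: #|F| m0; clear; lia.
case: k kV sF k2 => [|[|k]] // kV sF k2.
  by have := antichain_shadow sF aF; rewrite bin0 bin1 cV' cV; move: #|F|; clear; nia.
rewrite (card_link_deletion a F) mulnDr.
have -> : 'C(#|V|, k.+2) = 'C(#|V :\ a|, k.+1) + 'C(#|V :\ a|, k.+2).
  by rewrite cV cV' doubleS binS addnC.
apply: leq_add; apply: (antichain_odd cV').
- by move: kV; rewrite cV cV'; clear; lia.
- exact: ksub_link.
- exact: antichain_link.
- by move: k2; rewrite cV cV'; clear; lia.
- exact: ksub_deletion.
- exact: antichain_deletion.
Qed.

(** Comparing the tail counts at height [rho y] recovers the componentwise order. *)
Lemma dom_rk S T y z : dom S T -> y \in S -> z \in T -> rk T z = rk S y -> rho y <= rho z.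
Proof.
move=> d yS zT e; rewrite (rk_upc _ zT) e.
by apply: leq_trans (d (rho y)); rewrite -rk_upc.
Qed.

Lemma domC S T : dom S T -> dom (~: T) (~: S).
Proof. by move=> d x; rewrite -!setTD !upcD ?subsetT // leq_sub2l. Qed.

(** * From subsets to permutations *)

Section Relabel.
Variable P : {set I}.

(** For [#|S| = #|P|] there is one such [b]: it maps [P] onto [S] and complement onto complement,
    increasingly on each. *)
Definition relabels S (b : {perm I}) :=
  [forall y, if y \in P then (b y \in S) && (rk S (b y) == rk P y)
             else (b y \notin S) && (rk (~: S) (b y) == rk (~: P) y)].

Lemma ex_relabels S : #|S| = #|P| -> exists b, relabels S b.
Proof.
move=> cS.
have cSC : #|~: S| = #|~: P| by have := cardsC S; have := cardsC P; rewrite cS; lia.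
have [f fP] : exists f : I -> I, forall y, if y \in P then (f y \in S) && (rk S (f y) == rk P y)
             else (f y \notin S) && (rk (~: S) (f y) == rk (~: P) y).
  suff H y : exists z, if y \in P then (z \in S) && (rk S z == rk P y)
             else (z \notin S) && (rk (~: S) z == rk (~: P) y).
    by exists (fun y => xchoose (H y)) => y; apply: (xchooseP (H y)).
  case yP: (y \in P).
    have [|z zS e] := @rk_surj S (rk P y); first by rewrite cS rk_ltn.
    by exists z; rewrite zS e eqxx.
  have [|z zS e] := @rk_surj (~: S) (rk (~: P) y); first by rewrite cSC rk_ltn // inE yP.
  by exists z; rewrite e eqxx andbT; rewrite inE in zS.
have finj : injective f.
  move=> y z e; have := fP y; have := fP z; rewrite e.
  case: ifP => zP; case: ifP => yP.
  - by case/andP=> _ /eqP -> /andP[_ /eqP /rk_inj ->].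
  - by case/andP=> -> _.
  - by case/andP=> /negbTE -> _.
  - by case/andP=> _ /eqP -> /andP[_ /eqP /rk_inj -> //]; rewrite inE ?yP ?zP.
by exists (perm finj); apply/forallP => y; rewrite permE; apply: fP.
Qed.

Definition relabel S : {perm I} := odflt 1%g [pick b | relabels S b].

Lemma relabelP S : S \in ksub setT #|P| -> relabels S (relabel S).
Proof.
rewrite inE subsetT => /eqP cS; rewrite /relabel; case: pickP => // no.
by have [b] := ex_relabels cS; rewrite no.
Qed.

Lemma relabel_in S y : S \in ksub setT #|P| -> (relabel S y \in S) = (y \in P).
Proof.
move/relabelP/forallP/(_ y); case: ifP => _ /andP[//].
by move/negbTE.
Qed.

Lemma relabel_imset S (s : {perm I}) : S \in ksub setT #|P| ->
  ((s * relabel S)%g @: P == S) = (s @: P == P).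
Proof.
move=> Sk; have cS : #|S| = #|P| by move: Sk; rewrite inE subsetT => /eqP.
rewrite !eqEcard !card_imset ?cS ?leqnn ?andbT; try exact: perm_inj.
apply/subsetP/subsetP => h _ /imsetP[y yP ->].
  by rewrite -(relabel_in _ Sk); have := h _ (imset_f _ yP); rewrite permM.
by rewrite permM relabel_in //; apply: h; apply: imset_f.
Qed.

(** Equal ranks in [S] and [T] compare by [dom_rk]; the complements are dominated the other way
    round. *)
Lemma relabel_mono S T (s : {perm I}) : S \in ksub setT #|P| -> T \in ksub setT #|P| ->
  s @: P = P -> dom S T ->
  (forall p, p \in P -> rho ((s * relabel S)%g p) <= rho ((s * relabel T)%g p)) /\
  (forall p, p \notin P -> rho ((s * relabel T)%g p) <= rho ((s * relabel S)%g p)).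
Proof.
move=> Sk Tk sP d; split=> p pP; rewrite !permM.
  have sp : s p \in P by rewrite -sP imset_f.
  have /forallP/(_ (s p)) := relabelP Sk; have /forallP/(_ (s p)) := relabelP Tk.
  rewrite sp => /andP[h1 /eqP h2] /andP[h3 /eqP h4].
  by apply: dom_rk d h3 h1 _; rewrite h2.
have sp : s p \notin P by rewrite -sP (mem_imset _ _ (@perm_inj _ s)).
have /forallP/(_ (s p)) := relabelP Sk; have /forallP/(_ (s p)) := relabelP Tk.
rewrite (negbTE sp) => /andP[h1 /eqP h2] /andP[h3 /eqP h4].
by apply: dom_rk (domC d) _ _ _; rewrite ?inE // h2.
Qed.

(** Permutations are grouped by the image [S] of [P], and each group is translated by [relabel S] to
    the stabiliser of [P]. *)
Lemma card_relabel (F : {set {perm I}}) :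
  #|F| = \sum_(s : {perm I} | s @: P == P)
    #|[set S in ksub setT #|P| | (s * relabel S)%g \in F]|.
Proof.
under eq_bigr => s _ do rewrite -sum1_card.
transitivity (\sum_(S in ksub setT #|P|) \sum_(s in F | s @: P == S) 1).
  rewrite -sum1_card (partition_big (fun s : {perm I} => s @: P) (fun S => S \in ksub setT #|P|)) //.
  by move=> s _; rewrite inE subsetT (card_imset _ (@perm_inj _ s)) eqxx.
transitivity (\sum_(S in ksub setT #|P|)
    \sum_(s : {perm I} | (s @: P == P) && ((s * relabel S)%g \in F)) 1).
  apply: eq_bigr => S Sk; rewrite (reindex_inj (mulIg (relabel S))).
  by apply: eq_bigl => s; rewrite relabel_imset // andbC.
rewrite (exchange_big_dep (fun s : {perm I} => s @: P == P)) /=; last by move=> ? ? _ /andP[].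
apply: eq_bigr => s sP; apply: eq_bigl => S; rewrite [in RHS]inE.
by rewrite sP.
Qed.

(* Every permutation is uniquely [s * relabel S] with [s @: P = P]; for fixed [s]
   the sets [S] occurring in [F] form an antichain. *)
Theorem perm_family_bound q (F : {set {perm I}}) :
  (forall G : {set {set I}}, G \subset ksub setT #|P| -> antichain G ->
     q * #|G| <= 'C(#|[set: I]|, #|P|)) ->
  {in F &, forall s t : {perm I},
     (forall p, p \in P -> rho (s p) <= rho (t p)) ->
     (forall p, p \notin P -> rho (t p) <= rho (s p)) -> s @: P = t @: P} ->
  q * #|F| <= #|I|`!.
Proof.
move=> qG monoF.
(* The same decomposition of all permutations reduces the claim to one [s] at a time. *)
have -> : #|I|`! = \sum_(s : {perm I} | s @: P == P) 'C(#|[set: I]|, #|P|).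
  rewrite -cardsT -card_perm.
  have -> : #|perm_on [set: I]| = #|[set: {perm I}]|.
    by apply: eq_card => s; rewrite !inE; apply/subsetP.
  rewrite card_relabel; apply: eq_bigr => s _.
  by rewrite -card_ksub; apply: eq_card => S; rewrite !inE andbT.
rewrite card_relabel big_distrr; apply: leq_sum => s /eqP sP.
apply: qG => [|S T]; first by apply/subsetP => S; rewrite inE => /andP[].
rewrite !in_set => /andP[Sk SF] /andP[Tk TF] d.
have imE U : U \in ksub setT #|P| -> (s * relabel U)%g @: P = U.
  by move=> Uk; apply/eqP; rewrite relabel_imset // sP.
have {}Sk : S \in ksub setT #|P| by rewrite inE.
have {}Tk : T \in ksub setT #|P| by rewrite inE.
rewrite -(imE _ Sk) -(imE _ Tk).
by have [h1 h2] := relabel_mono Sk Tk sP d; apply: monoF.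
Qed.

End Relabel.

End Dominance.

(** * Upper bound for the orthogonality count *)

Import Order.TTheory GRing.Theory Num.Theory.
Local Open Scope ring_scope.

Lemma sum_permE (M : nmodType) n (s : 'S_n) (f : 'I_n -> M) :
  \sum_i f (s i) = \sum_i f i.
Proof. by rewrite [RHS](reindex_inj (@perm_inj _ s)). Qed.

Lemma orthcountE (R : realType) n (v w : 'rV[R]_n) :
  orthcount v w = #|[set s : 'S_n | \sum_i w ord0 i * v ord0 (s i) == 0]|.
Proof.
rewrite /orthcount -(card_imset _ (@invg_inj 'S_n)).
apply: eq_card => s; rewrite -[in LHS](invgK s) (mem_imset _ _ (@invg_inj _)) !inE.
by rewrite /dotv; under eq_bigr => i _ do rewrite mxE invgK.
Qed.

Section UpperBound.
Variables (R : realType) (n : nat) (v w : 'rV[R]_n).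
Hypothesis v_inj : distinct_coords v.

(** Turns the real order of the coordinates into a natural-number height, to serve as [rho]. *)
Definition vrank (i : 'I_n) : nat := #|[set j | v ord0 j < v ord0 i]|.

Lemma vrank_le i j : (vrank i <= vrank j)%N = (v ord0 i <= v ord0 j).
Proof.
case: (leP (v ord0 i) (v ord0 j)) => h.
  apply: subset_leq_card; apply/subsetP => k; rewrite !inE => /lt_le_trans; exact.
apply/negbTE; rewrite -ltnNge; apply: proper_card; apply/properP; split.
  by apply/subsetP => k; rewrite !inE => /lt_trans; apply.
by exists j; rewrite !inE ?h // ltxx.
Qed.

Lemma vrank_inj : injective vrank.
Proof.
by move=> i j e; apply: v_inj; apply/eqP; rewrite eq_le -!vrank_le e leqnn.
Qed.

(** Subtracting [theta] from [w] keeps the two products equal, as [s] and [t] only permute [v]. The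
    difference is then a sum of nonnegative terms, so each term vanishes. *)
Lemma exchange_rigid (theta : R) (s t : 'S_n) (P := [set i | theta <= w ord0 i]) :
  \sum_i w ord0 i * v ord0 (s i) = \sum_i w ord0 i * v ord0 (t i) ->
  (forall p, p \in P -> (vrank (s p) <= vrank (t p))%N) ->
  (forall p, p \notin P -> (vrank (t p) <= vrank (s p))%N) -> s @: P = t @: P.
Proof.
move=> e hP hN.
have z0 : \sum_i (w ord0 i - theta) * (v ord0 (t i) - v ord0 (s i)) = 0.
  under eq_bigr => i _ do rewrite mulrBl !mulrBr.
  by rewrite !sumrB -!mulr_sumr !(sum_permE _ (v ord0)) e !subrr.
have pos i : true -> 0 <= (w ord0 i - theta) * (v ord0 (t i) - v ord0 (s i)).
  move=> _; case: (boolP (i \in P)) => iP.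
    by rewrite mulr_ge0 ?subr_ge0 -?vrank_le ?hP //; move: iP; rewrite inE.
  rewrite mulr_le0 ?subr_le0 -?vrank_le ?hN // ltW //.
  by move: iP; rewrite inE -ltNge.
(* Off [P] the factor [w - theta] is strictly negative, so [s] and [t] agree there; on [P] it may
   vanish, so only the images agree. *)
have st p : p \notin P -> t p = s p.
  move=> pP; have := psumr_eq0P pos z0; move=> /(_ p isT)/eqP.
  rewrite mulf_eq0 !subr_eq0 => /orP[/eqP h|/eqP /v_inj //].
  by move: pP; rewrite inE h lexx.
apply/eqP; rewrite eqEcard !card_imset ?leqnn ?andbT; try exact: perm_inj.
apply/subsetP => _ /imsetP[p pP ->].
have tK : t ((t^-1)%g (s p)) = s p by rewrite permKV.
rewrite -tK imset_f //; apply/negPn/negP => h.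
by have := st _ h; rewrite tK => /perm_inj e'; rewrite -e' pP in h.
Qed.

Lemma orthcount_bound q : (q = if odd n then n else n.-1)%N ->
  (exists i j, w ord0 i != w ord0 j) -> (q * orthcount v w <= n`!)%N.
Proof.
move=> qE [i [j ij]].
wlog h : i j ij / w ord0 i < w ord0 j => [H|].
  case: (ltgtP (w ord0 i) (w ord0 j)) (ij) => [h _|h _|_ //]; first exact: (H i j).
  by apply: (H j i) => //; rewrite eq_sym.
(* The threshold [w ord0 j] puts [j] in [P] and [i] outside, so both blocks are nonempty. *)
pose P := [set k | w ord0 j <= w ord0 k].
have kP : (0 < #|P| < #|[set: 'I_n]|)%N.
  apply/andP; split; first by apply/card_gt0P; exists j; rewrite inE lexx.
  apply: proper_card; apply/properP; split; first exact: subsetT.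
  by exists i; rewrite !inE // -ltNge.
rewrite orthcountE -[in X in (_ <= X)%N](card_ord n).
apply: (@perm_family_bound _ vrank vrank_inj P) => [G sG aG|s t].
  rewrite qE; have cT : #|[set: 'I_n]| = n by rewrite cardsT card_ord.
  case on: (odd n).
    rewrite -{1}cT; apply: (antichain_odd vrank_inj (m := n./2)) kP sG aG.
    by rewrite cT -[LHS]odd_double_half on.
  rewrite -{1}cT -subn1; apply: (antichain_even vrank_inj (m := n./2.-1)) kP sG aG.
  have n0 : (0 < n)%N by apply: leq_ltn_trans (ltn_ord i).
  rewrite cT prednK; first by rewrite -[LHS]odd_double_half on.
  by rewrite half_gt0; case: (n) on n0 => [|[]].
by rewrite !inE => /eqP es /eqP et; apply: exchange_rigid; rewrite es et.
Qed.

End UpperBound.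

Lemma fact_halves n : (3 <= n)%N ->
  (2 * (n %/ 2) * (n - 2)`! = if odd n then (n - 1)`! else n * (n - 2)`!)%N.
Proof.
case: n => [|[|n]] // _; rewrite !subSS subn0 divn2 mul2n.
have := odd_double_half n.+2; case: (odd n.+2).
  by rewrite add1n => /succn_inj ->; rewrite factS.
by rewrite add0n => ->.
Qed.

Lemma orthcount_le (R : realType) n (v w : 'rV[R]_n) : (3 <= n)%N ->
  admissible v w -> (orthcount v w <= 2 * (n %/ 2) * (n - 2)`!)%N.
Proof.
move=> hn [v_inj sv wn0].
case: (boolP [exists i, exists j, w ord0 i != w ord0 j]) => [|const].
  case/existsP=> i /existsP[j ij].
  have := @orthcount_bound R n v w v_inj _ erefl; move: (orthcount v w) => c.
  move=> /(_ (ex_intro _ i (ex_intro _ j ij))).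
  rewrite fact_halves //; case: n hn {v w v_inj sv wn0 i j ij} => [|[|n]] // _.
  rewrite !subSS !subn0; case: (odd _).
    by rewrite factS leq_pmul2l.
  by rewrite !factS mulnCA leq_pmul2l.
(* For constant [w] every product is that nonzero constant times the coordinate sum of [v], which is
   nonzero. *)
rewrite orthcountE; set X := [set _ | _]; suff -> : X = set0 by rewrite cards0.
apply/setP => s; rewrite !inE; apply/negbTE.
have n0 : (0 < n)%N by apply: leq_trans hn.
have wE i : w ord0 i = w ord0 (Ordinal n0).
  apply/eqP; move/existsPn: const => /(_ i)/existsPn/(_ (Ordinal n0)).
  by rewrite negbK.
under eq_bigr => i _ do rewrite wE.
rewrite -mulr_sumr (sum_permE s (v ord0)).
rewrite mulf_neq0 //.
  apply: contra wn0 => /eqP w0; apply/eqP/rowP => i.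
  by rewrite mxE wE.
by move: sv; rewrite /dotv; under eq_bigr => i _ do rewrite mxE mulr1.
Qed.

(** * The extremal pair *)

Section Attained.
Variables (R : realType) (n : nat).

Definition ramp : 'rV[R]_n := \row_i i%:R.

(** The shift by [2 / n] makes the coordinates sum to zero; against [ramp] it subtracts [n - 1],
    twice the mean coordinate. *)
Definition tilted_pair : 'rV[R]_n := \row_i ((i < 2)%:R - 2 / n%:R).

Lemma sum_ramp : \sum_(i < n) ramp ord0 i = n%:R * (n%:R - 1) / 2.
Proof.
under eq_bigr => i _ do rewrite mxE.
elim: n => [|m IHm]; first by rewrite big_ord0 !mul0r.
by rewrite big_ord_recr /= IHm -[m.+1]addn1 natrD; field.
Qed.

Hypothesis hn : (3 <= n)%N.

Lemma ramp_admissible : admissible ramp tilted_pair.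
Proof.
have n0 : n%:R != 0 :> R by rewrite pnatr_eq0; case: n hn.
split.
- move=> i j; rewrite /= !mxE => /eqP; rewrite eqr_nat => /eqP; exact: val_inj.
- rewrite /dotv; under eq_bigr => i _ do rewrite [X in _ * X]mxE mulr1.
  rewrite sum_ramp; apply: mulf_neq0; last by rewrite invr_eq0 pnatr_eq0.
  apply: mulf_neq0 => //.
  by rewrite subr_eq0 pnatr_eq1; case: n hn => [|[|]].
apply/negP => /eqP/rowP/(_ (Ordinal (leq_trans (isT : 0 < 3)%N hn))).
rewrite !mxE /= => /eqP; rewrite subr_eq0 eq_sym => /eqP e.
have : 2 = n%:R :> R by rewrite -[LHS](mulfVK n0) e mul1r.
by move/eqP; rewrite eqr_nat => /eqP h; move: hn; rewrite -h.
Qed.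

Lemma dot_ramp (s : 'S_n) (i j : 'I_n) : i = 0%N :> nat -> j = 1%N :> nat ->
  \sum_k tilted_pair ord0 k * ramp ord0 (s k) = (s i)%:R + (s j)%:R - (n%:R - 1).
Proof.
move=> i0 j1.
have n0 : n%:R != 0 :> R by rewrite pnatr_eq0; case: n hn.
under eq_bigr => k _ do rewrite mxE mulrBl.
rewrite sumrB -mulr_sumr (sum_permE s (ramp ord0)) sum_ramp.
have ij : j != i by rewrite -val_eqE /= i0 j1.
rewrite (bigD1 i) //= (bigD1 j) //= big1 ?addr0.
  rewrite i0 j1 /= !mul1r !mxE; congr (_ + _ - _).
  by field.
move=> k /andP[ki kj]; suff -> : (k < 2)%N = false by rewrite mul0r.
by move: ki kj; rewrite -!val_eqE /= i0 j1; case: (val k) => [|[]].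
Qed.

(** The set is a translate, by one permutation [t] with these two values, of the permutations fixing
    [i] and [j]. *)
Lemma card_perm2 (i j a b : 'I_n) : i != j -> a != b ->
  #|[set s : 'S_n | (s i == a) && (s j == b)]| = (n - 2)`!.
Proof.
move=> ij ab.
have [t [ti tj]] : exists t : 'S_n, t i = a /\ t j = b.
  exists (tperm j (tperm i a b) * tperm i a)%g.
  have jb : tperm i a b != i.
    by apply: contra ab => /eqP e; rewrite -(tpermK i a b) e tpermL.
  split; rewrite permM; [|by rewrite tpermL tpermK].
  by rewrite (tpermD (x := j)) ?tpermL // eq_sym.
have -> : (n - 2)%N = #|~: [set i; j]|.
  by have := cardsC [set i; j]; rewrite cards2 ij card_ord => h; apply/eqP; rewrite -(eqn_add2l 2) h subnKC // ltnW.
rewrite -card_perm -[RHS](card_imset _ (@mulIg _ t)).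
apply: eq_card => s; rewrite inE; apply/andP/imsetP => [[/eqP si /eqP sj]|[u uP ->]].
  exists (s * t^-1)%g; last by rewrite mulgKV.
  apply/subsetP => k; rewrite !inE; apply: contra => /orP[]/eqP ->.
    by rewrite permM si -ti permK.
  by rewrite permM sj -tj permK.
by rewrite !permM !(out_perm uP) ?inE ?eqxx ?orbT // ti tj.
Qed.

(** The product vanishes when the images of 0 and 1 are [a] and [n - 1 - a]. Each [a] other than the
    middle index gives [(n - 2)!] permutations. *)
Lemma orthcount_ramp : (2 * (n %/ 2) * (n - 2)`! <= orthcount ramp tilted_pair)%N.
Proof.
pose i := Ordinal (leq_trans (isT : 0 < 3)%N hn).
pose j := Ordinal (leq_trans (isT : 1 < 3)%N hn).
have ij : i != j by [].
rewrite orthcountE.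
pose X (a : 'I_n) := [set s : 'S_n | (s i == a) && (s j == rev_ord a)].
apply: (@leq_trans (\sum_(a : 'I_n | a != rev_ord a) #|X a|)); last first.
  set F := [set s : 'S_n | _]; rewrite -[#|F|]sum1_card.
  rewrite (partition_big (fun s : 'S_n => s i) xpredT) //= big_mkcond /=.
  apply: leq_sum => a _; case: ifP => // an; rewrite sum1_card.
  apply: subset_leq_card; apply/subsetP => s; rewrite inE => /andP[/eqP si /eqP sj].
  rewrite unfold_in /= si eqxx andbT inE (@dot_ramp s i j) // si sj.
  rewrite -natrD subr_eq0 -[1 in X in _ == X]/(1%:R) -natrB; last by case: n hn.
  by rewrite eqr_nat /=; have := ltn_ord a; lia.
under eq_bigr => a an do rewrite card_perm2 //.
rewrite sum_nat_const leq_mul2r; apply/orP; right.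
(* [a = n - 1 - a] has a solution only for odd [n], and then just one. *)
have : (#|[pred a : 'I_n | a == rev_ord a]| <= odd n)%N.
  case on: (odd n).
    apply/card_le1P => a; rewrite inE => /eqP ea b; rewrite !inE.
    apply/idP/idP => [/eqP eb|/eqP -> //]; last by rewrite -ea.
    apply/eqP/val_inj; have := congr1 val ea; have := congr1 val eb => /=.
    by have := ltn_ord a; have := ltn_ord b; lia.
  rewrite leqn0; apply/eqP/eq_card0 => a; rewrite !inE; apply/negP => /eqP/(congr1 val) /=.
  by have := ltn_ord a; lia.
have := cardC [pred a : 'I_n | a == rev_ord a]; rewrite card_ord.
have -> : #|[predC [pred a : 'I_n | a == rev_ord a]]| = #|[pred a : 'I_n | a != rev_ord a]|.
  by apply: eq_card => a; rewrite !inE.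
have := odd_double_half n; rewrite divn2 mul2n.
move: #|_| #|_| => x y; lia.
Qed.

End Attained.

Theorem theorem1p1 (R : realType) (n : nat) (hn : (3 <= n)%N) :
  is_maximum
    (fun k : nat => exists v w : 'rV[R]_n, admissible v w /\ k = orthcount v w)
    (2 * (n %/ 2) * (n - 2)`!)%N /\
  (2 * (n %/ 2) * (n - 2)`! =
     if odd n then (n - 1)`! else n * (n - 2)`!)%N.
Proof.
split; last exact: fact_halves.
split; last by move=> _ [v [w [adm ->]]]; apply: orthcount_le.
exists (ramp R n), (tilted_pair R n); have adm := ramp_admissible R hn; split=> //.
by apply/eqP; rewrite eqn_leq orthcount_ramp ?orthcount_le.
Qed.
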